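(* Let $G$ be a finitely generated virtually free group having a free subgroup $F$ of finite index, $H\leq G$ and $\varphi\in \mathrm{End}(G)$ be an endomorphism. If $\mathrm{Ker}(\varphi)$ is finite, then $H\varphi^{-1}$ is finitely generated. If not, the following are equivalent: 1. $H\varphi^{-1}$ is finitely generated; 2. $H\varphi^{-1}\cap F$ is a finite index subgroup of $F$; 3. $H\varphi^{-1}\cap F$ is a finite index subgroup of $G$; 4. $H\varphi^{-1}$ is a finite index subgroup of $G$; 5. $H\cap G\varphi$ is a finite index subgroup of $G\varphi$; 6. $H\cap F\varphi$ is a finite index subgroup of $F\varphi$.
   Context: Maps are written on the right: $G\varphi$ and $F\varphi$ denote the images of $G$ and $F$ under $\varphi$, and $H\varphi^{-1}=\{x\in G\mid x\varphi\in H\}$ is the full preimage of $H$. $\mathrm{End}(G)$ is the set of endomorphisms of $G$, and $\mathrm{Ker}(\varphi)$ is the kernel of $\varphi$.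
   Formalization: In the first claim (Ker(φ) finite) H is additionally assumed finitely generated; otherwise it fails, e.g. G=F free of rank 2, φ the identity, H=[F,F]. The equivalence is for every subgroup H. *)

(* Defs.v *)
From HB Require Import structures.
From mathcomp Require Export all_boot.
From mathcomp Require Export boolp classical_sets functions cardinality.

Set Implicit Arguments.
Unset Strict Implicit.
Unset Printing Implicit Defensive.

Local Open Scope classical_set_scope.
Local Open Scope group_scope.

Section Groups.
Context {G : groupType}.
Implicit Types (A K L X : set G) (x y : G).

Definition is_subgroup K : Prop :=
  [/\ K 1, forall x y, K x -> K y -> K (x * y) & forall x, K x -> K x^-1].

Definition generated A : set G := smallest is_subgroup A.

Definition finitely_generated K : Prop :=
  exists2 A : set G, finite_set A & K = generated A.

Definition lcoset x K : set G := [set x * k | k in K].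

Definition finite_index_subgroup K L : Prop :=
  [/\ is_subgroup K, K `<=` L & finite_set [set lcoset x K | x in L]].

(* A word over X is a sequence of letters (x, e) with x in X; the letter
   (x, false) stands for x and (x, true) for its formal inverse. *)
Definition letter_value (a : G * bool) : G := if a.2 then a.1^-1 else a.1.

Definition word_value (w : seq (G * bool)) : G := \prod_(a <- w) letter_value a.

Definition reduced (w : seq (G * bool)) : bool :=
  sorted [rel a b | b != (a.1, ~~ a.2)] w.

Definition reduced_words X : set (seq (G * bool)) :=
  [set w | reduced w /\ forall a, a \in w -> X a.1].

(* The reduced words over X are the elements of the free group on X, and
   word_value is the homomorphism from it to G extending the inclusion of X:
   K is free on X when this homomorphism is a bijection onto K. *)
Definition is_basis X K : Prop := set_bij (reduced_words X) K word_value.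

Definition is_free K : Prop := exists X : set G, is_basis X K.

End Groups.

(* Main.v *)
Require Import Defs.

(** Here is why the proposition holds. Conditions 2 to 6 are linked by
    transitivity, images and preimages of finite index ([finite_index_trans],
    [finite_index_image], [finite_indexI]), and condition 6 makes the preimage
    of [H] a subgroup of finite index in a finitely generated group, hence
    finitely generated by Schreier's argument
    ([finite_index_finitely_generated]).

    Everything else takes place in the free group [F], with basis [X]. A reduced
    word spells a path from the trivial coset in the graph whose vertices are
    the right cosets of a subgroup [K] and whose edges are multiplications by
    letters; the reduced words of elements of [K] spell closed paths. Call [K]
    quasiconvex when these closed paths together meet only finitely many
    vertices. Finitely generated subgroups are quasiconvex
    ([finitely_generated_quasiconvex]), and the converse holds when [X] is finite
    ([quasiconvex_finitely_generated]); [X] is finite here because [F], being of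
    finite index in [G], is finitely generated ([finite_basis]).

    For the passage from 1 to 2, an infinite kernel meets [F] in a nontrivial
    normal subgroup [N] of [F], contained in [K], the intersection of [F] and the
    preimage of [H]. Normality puts a closed path spelled by an element of [N]
    at every vertex, and from this [coset_cover_of_normal] deduces that a
    quasiconvex [K] has only the finitely many cosets met by its closed paths.

    For a finite kernel, quasiconvexity passes to intersections, since a coset of
    an intersection is determined by the cosets of the two subgroups that
    contain it. This gives Howson's theorem in [F], hence in [G]
    ([virtually_free_Howson]), so that [H] meets the image of [phi] in a finitely
    generated group; its preimage is generated by lifts of the generators
    and by the kernel ([finitely_generated_preimage]). *)

Set Implicit Arguments.
Unset Strict Implicit.
Unset Printing Implicit Defensive.

Local Open Scope classical_set_scope.
Local Open Scope group_scope.

(** * Subgroups and words *)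

Section Subgroups.
Context {G : groupType}.
Implicit Types (A K L M X : set G) (x y : G) (T : seq G) (w : seq (G * bool)).

Lemma subgroup_div K x y : is_subgroup K -> K x -> K y -> K (x * y^-1).
Proof. by case=> _ KM KV Kx Ky; apply: KM => //; apply: KV. Qed.

Lemma subgroup_divr K x y z :
  is_subgroup K -> K (x * z^-1) -> K (y * z^-1) -> K (x * y^-1).
Proof.
by move=> Ks Kx Ky; move: (subgroup_div Ks Kx Ky); rewrite invgF divgKA.
Qed.

Lemma subgroupI K L : is_subgroup K -> is_subgroup L -> is_subgroup (K `&` L).
Proof.
move=> [K1 KM KV] [L1 LM LV]; split=> // [x y [Kx Lx] [Ky Ly]|x [Kx Lx]].
  by split; [apply: KM | apply: LM].
by split; [apply: KV | apply: LV].
Qed.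

Lemma subgroupT : is_subgroup [set: G]. Proof. by []. Qed.

Lemma subgroup_generated A : is_subgroup (generated A).
Proof.
split=> [M [[M1 _ _] _] //|x y Ax Ay M [Ms AM]|x Ax M [Ms AM]].
  by have [_ MM _] := Ms; apply: MM; [apply: Ax | apply: Ay].
by have [_ _ MV] := Ms; apply: MV; apply: Ax.
Qed.

Lemma finitely_generated_subgroup K : finitely_generated K -> is_subgroup K.
Proof. by case=> A _ ->; apply: subgroup_generated. Qed.

Definition word_over X w : Prop := forall a, a \in w -> X a.1.

Lemma word_over_cons X a w :
  word_over X (a :: w) <-> X a.1 /\ word_over X w.
Proof.
split=> [Xw|[Xa Xw] b].
  by split=> [|b wb]; apply: Xw; rewrite inE ?eqxx ?wb ?orbT.
by rewrite inE => /predU1P[->|/Xw].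
Qed.

Lemma word_over_cat X w1 w2 :
  word_over X (w1 ++ w2) <-> word_over X w1 /\ word_over X w2.
Proof.
elim: w1 => [|a w1 IH] /=; first by split=> [|[]].
by split=> [/word_over_cons[Xa /IH[]]|[/word_over_cons[Xa X1] X2]];
  [split=> //; apply/word_over_cons | apply/word_over_cons; split=> //; apply/IH].
Qed.

Lemma word_value_cons a w : word_value (a :: w) = letter_value a * word_value w.
Proof. by rewrite /word_value big_cons. Qed.

Lemma word_value_nil : word_value [::] = 1 :> G.
Proof. by rewrite /word_value big_nil. Qed.

Lemma word_value1 a : word_value [:: a] = letter_value a :> G.
Proof. by rewrite word_value_cons word_value_nil mulg1. Qed.

Lemma word_value_cat w1 w2 :
  word_value (w1 ++ w2) = word_value w1 * word_value w2.
Proof. by rewrite /word_value big_cat. Qed.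

Lemma letter_value_in K a : is_subgroup K -> K a.1 -> K (letter_value a).
Proof. by case=> _ _ KV; rewrite /letter_value; case: a.2 => // /KV. Qed.

Lemma word_value_in X K w :
  is_subgroup K -> X `<=` K -> word_over X w -> K (word_value w).
Proof.
move=> Ks XK; have [K1 KM _] := Ks.
elim: w => [|a w IH]; first by rewrite word_value_nil.
move=> /word_over_cons[Xa /IH Kw]; rewrite word_value_cons.
by apply: KM => //; apply: letter_value_in => //; apply: XK.
Qed.

Definition inv_letter (a : G * bool) : G * bool := (a.1, ~~ a.2).

Definition inv_word w : seq (G * bool) := rev (map inv_letter w).

Lemma inv_letterK : involutive inv_letter.
Proof. by case=> x e; rewrite /inv_letter /= negbK. Qed.

Lemma inv_wordK : involutive inv_word.
Proof.
by move=> w; rewrite /inv_word map_rev revK -map_comp map_id_in // => a _;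
  apply: inv_letterK.
Qed.

Lemma inv_word_cat w1 w2 : inv_word (w1 ++ w2) = inv_word w2 ++ inv_word w1.
Proof. by rewrite /inv_word map_cat rev_cat. Qed.

Lemma inv_word_cons a w : inv_word (a :: w) = rcons (inv_word w) (inv_letter a).
Proof. by rewrite /inv_word /= rev_cons. Qed.

Lemma letter_valueV a : letter_value (inv_letter a) = (letter_value a)^-1 :> G.
Proof. by case: a => x []; rewrite /letter_value /= ?invgK. Qed.

Lemma word_valueV w : word_value (inv_word w) = (word_value w)^-1.
Proof.
elim: w => [|a w IH]; first by rewrite word_value_nil invg1.
rewrite inv_word_cons -cats1 word_value_cat word_value1 IH letter_valueV.
by rewrite word_value_cons invgM.
Qed.

Lemma word_over_inv X w : word_over X w -> word_over X (inv_word w).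
Proof. by move=> Xw a; rewrite mem_rev => /mapP[b /Xw Xb ->]. Qed.

Lemma generatedP A x :
  generated A x <-> exists2 w, word_over A w & word_value w = x.
Proof.
split=> [Ax|[w Aw <-]]; last first.
  move=> M [Ms AM]; exact: word_value_in Aw.
apply: (Ax [set x | exists2 w, word_over A w & word_value w = x]).
split; last first.
  move=> a Aa; exists [:: (a, false)]; last by rewrite word_value1.
  by apply/word_over_cons; split.
split=> [|_ _ [v Av <-] [w Aw <-]|_ [w Aw <-]].
- by exists [::] => //; rewrite word_value_nil.
- by exists (v ++ w); [apply/word_over_cat | rewrite word_value_cat].
- by exists (inv_word w); [apply: word_over_inv | rewrite word_valueV].
Qed.

Lemma finitely_generatedP K :
  finitely_generated K <-> exists s : seq G, K = generated [set` s].
Proof.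
split=> [[A /finite_seqP[s ->] ->]|[s ->]]; first by exists s.
by exists [set` s] => //; apply: finite_seq.
Qed.

Lemma generated_sub A K : is_subgroup K -> A `<=` K -> generated A `<=` K.
Proof. by move=> Ks AK; apply: smallest_sub. Qed.

Lemma sub_generated A : A `<=` generated A.
Proof. exact: sub_smallest. Qed.

(** * Finite index and finite generation *)

(** The union of the right cosets [K * t]. Right cosets are used because reading
    a word from left to right multiplies on the right; a list of
    representatives, allowed to be redundant, makes the union finite. *)
Definition coset_cover K T : set G :=
  [set x | exists2 t, t \in T & K (x * t^-1)].

Lemma coset_coverMl K T k x :
  is_subgroup K -> K k -> coset_cover K T x -> coset_cover K T (k * x).
Proof.
by move=> [_ KM _] Kk [t Tt Kx]; exists t => //; rewrite -mulgA; apply: KM.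
Qed.

Lemma finite_index_cover K L :
    is_subgroup L -> finite_index_subgroup K L ->
  exists2 T, [set` T] `<=` L & L `<=` coset_cover K T.
Proof.
move=> Ls [[K1 KM KV] KL /finite_seqP[s eq_s]].
have [_ _ LV] := Ls.
pose P c : set G := [set x | L x /\ lcoset x K = c].
have PP c : c \in s -> P c (xget 1 (P c)).
  move=> sc; apply: xgetPex.
  have : [set lcoset x K | x in L] c by rewrite eq_s.
  by case=> x Lx <-; exists x.
(* Inversion turns representatives of left cosets into representatives of
   right cosets. *)
exists [seq (xget 1 (P c))^-1 | c <- s].
  by move=> _ /mapP[c /PP[Lc _] ->]; apply: LV.
move=> x Lx.
have sx : lcoset x^-1 K \in s.
  suff : [set lcoset x K | x in L] (lcoset x^-1 K) by rewrite eq_s.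
  by exists x^-1 => //; apply: LV.
exists (xget 1 (P (lcoset x^-1 K)))^-1; first exact: map_f.
have [_ eq_c] := PP _ sx.
have [k Kk <-] : lcoset x^-1 K (xget 1 (P (lcoset x^-1 K))).
  by rewrite -{1}eq_c; exists 1 => //; rewrite mulg1.
by rewrite invgK mulVKg.
Qed.

Lemma cover_finite_index K L T :
    is_subgroup K -> is_subgroup L -> K `<=` L -> L `<=` coset_cover K T ->
  finite_index_subgroup K L.
Proof.
move=> Ks Ls KL LT; have [K1 KM KV] := Ks; have [_ _ LV] := Ls.
split=> //.
apply: (@sub_finite_set _ _ [set lcoset t^-1 K | t in [set` T]]); last first.
  by apply: finite_image; apply: finite_seq.
move=> _ [x Lx <-]; have [t Tt Kxt] := LT _ (LV _ Lx).
exists t => //; apply/seteqP; split=> _ [k Kk <-] /=.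
  exists (x^-1 * t^-1 * k); first exact: KM.
  by rewrite !mulgA mulgV mul1g.
exists ((x^-1 * t^-1)^-1 * k); first by apply: KM => //; apply: KV.
by rewrite invgM !invgK !mulgA mulVg mul1g.
Qed.

Lemma coset_cover_trans K L T U :
    L `<=` coset_cover K T ->
  coset_cover L U `<=` coset_cover K [seq t * u | t <- T, u <- U].
Proof.
move=> LT x [u Uu /LT[t Tt Kxt]]; exists (t * u); first exact: allpairs_f.
by rewrite invgM mulgA.
Qed.

Lemma finite_index_trans K L M :
    is_subgroup L -> is_subgroup M ->
    finite_index_subgroup K L -> finite_index_subgroup L M ->
  finite_index_subgroup K M.
Proof.
move=> Ls Ms KL LM; have [T _ LT] := finite_index_cover Ls KL.
have [U _ MU] := finite_index_cover Ms LM.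
have [Ks sKL _] := KL; have [_ sLM _] := LM.
apply: (@cover_finite_index K M [seq t * u | t <- T, u <- U]) => //.
  exact: subset_trans sLM.
by move=> x /MU; apply: coset_cover_trans.
Qed.

(** A nonempty intersection of a right coset of [K] and one of [L] is a right
    coset of the intersection of [K] and [L]. *)
Lemma coset_coverI K L T U : is_subgroup K -> is_subgroup L ->
  exists V, coset_cover K T `&` coset_cover L U `<=` coset_cover (K `&` L) V.
Proof.
move=> Ks Ls.
pose P t u : set G := [set y | K (y * t^-1) /\ L (y * u^-1)].
exists [seq xget 1 (P t u) | t <- T, u <- U] => x [[t Tt Kx] [u Uu Lx]].
exists (xget 1 (P t u)); first exact: (allpairs_f (fun t u => xget 1 (P t u))).
have [Ky Ly] : P t u (xget 1 (P t u)) by apply: xgetPex; exists x.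
by split; [apply: subgroup_divr Kx Ky | apply: subgroup_divr Lx Ly].
Qed.

Lemma finite_indexI K L M :
    is_subgroup L -> is_subgroup M ->
    finite_index_subgroup K L ->
  finite_index_subgroup (K `&` M) (L `&` M).
Proof.
move=> Ls Ms KL; have [T _ LT] := finite_index_cover Ls KL.
have [Ks sKL _] := KL.
have [V sV] := coset_coverI T [:: 1] Ks Ms.
apply: (cover_finite_index (T := V)); [exact: subgroupI | exact: subgroupI | | ].
  exact: setSI.
move=> x [Lx Mx]; apply: sV; split; first exact: LT.
by exists 1; rewrite ?inE ?invg1 ?mulg1.
Qed.

(** Schreier's argument: if [w] spells an element of [K] and its prefixes end
    in the cosets [K t], inserting [t^-1 * t] after each letter of [w] writes
    that element with the finitely many elements of [K] of the form
    [t * a * u^-1], where [t] and [u] are representatives and [a] is a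
    letter. Schreier's theorem on subgroups of finite index and the finite
    generation of quasiconvex subgroups are both instances. *)
Lemma covered_words_finitely_generated (s : seq G) T K : is_subgroup K ->
    (forall k, K k -> exists w, [/\ word_over [set` s] w, word_value w = k &
       forall i, coset_cover K T (word_value (take i w))]) ->
  finitely_generated K.
Proof.
move=> Ks Kw; have [K1 KM KV] := Ks.
pose letters := [seq letter_value (a, e) | a <- s, e <- [:: false; true]].
(* The representatives that lie in [K] serve at the two ends of the path, since
   1 need not be among the representatives. *)
pose B := [seq z * u^-1 | z <- [seq t * x | t <- T, x <- letters], u <- T] ++ T.
pose C := [seq b <- B | `[< K b >]].
have CK : [set` C] `<=` K by move=> b; rewrite /= mem_filter => /andP[/asboolP].
apply/finitely_generatedP; exists C.
apply/seteqP; split; last exact: generated_sub.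
have [C1 CM CV] := subgroup_generated [set` C].
have inC b : b \in B -> K b -> generated [set` C] b.
  by move=> Bb Kb; apply: sub_generated; rewrite /= mem_filter Bb andbT asboolE.
have inCT t : t \in T -> K t -> generated [set` C] t.
  by move=> Tt; apply: inC; rewrite mem_cat Tt orbT.
(* [t^-1] closes up the path spelled by [w], which ends in the coset [K t]. *)
have walk w : word_over [set` s] w ->
    (forall i, coset_cover K T (word_value (take i w))) ->
    forall t, t \in T -> K (word_value w * t^-1) ->
  generated [set` C] (word_value w * t^-1).
  elim/last_ind: w => [|w a IH] sw Tw t Tt.
    rewrite word_value_nil mul1g => Kt; apply: CV; apply: inCT => //.
    by rewrite -(invgK t); apply: KV.
  move: sw; rewrite -cats1 => /word_over_cat[sw sa].
  have wP i : coset_cover K T (word_value (take i w)).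
    have [le_i|gt_i] := leqP i (size w).
      by move: (Tw i); rewrite -cats1 takel_cat.
    move: (Tw (size w)).
    by rewrite (take_oversize (ltnW gt_i)) -cats1 take_size_cat.
  have := wP (size w); rewrite take_size => -[u Tu Ku].
  have Cu := IH sw wP u Tu Ku.
  rewrite word_value_cat word_value1 => Kt.
  set x := letter_value a in Kt *; set y := word_value w in Ku Cu Kt *.
  have eq_x : y * x * t^-1 = y * u^-1 * (u * x * t^-1).
    by rewrite !mulgA mulgVK.
  rewrite eq_x; apply: CM => //; apply: inC.
    rewrite mem_cat; apply/orP; left.
    apply: (allpairs_f (fun z u => z * u^-1)) => //.
    apply: (allpairs_f (fun t x => t * x)) => //.
    have sa1 : a.1 \in s by apply: sa; rewrite inE eqxx.
    rewrite /x; case: a sa1 {sa Tw x Kt eq_x} => a e /= sa1.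
    by apply: (allpairs_f (fun a e => letter_value (a, e))) => //; case: e.
  rewrite -[u * x * t^-1](mulKg (y * u^-1)) -eq_x.
  by apply: KM => //; apply: KV.
move=> k Kk; have [w [sw eq_k wP]] := Kw _ Kk.
have := wP (size w); rewrite take_size => -[t Tt Kt].
have Ct := walk _ sw wP t Tt Kt.
have Kt' : K t.
  rewrite -[t]invgK; apply: (KV); rewrite -(mulKg k t^-1).
  by apply: KM; [apply: KV | rewrite -eq_k].
by rewrite -(mulgVK t k) -eq_k; apply: CM => //; apply: inCT.
Qed.

Lemma finite_index_finitely_generated K L :
  finite_index_subgroup K L -> finitely_generated L -> finitely_generated K.
Proof.
move=> KL Lfg; have Ls := finitely_generated_subgroup Lfg.
have [T _ LT] := finite_index_cover Ls KL; have [Ks sKL _] := KL.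
move/finitely_generatedP: Lfg => [s eqL].
apply: (@covered_words_finitely_generated s T) => // k /sKL.
rewrite eqL => /generatedP[w sw eq_k]; exists w; split=> // i; apply: LT.
rewrite eqL; apply/generatedP; exists (take i w) => //.
by move: sw; rewrite -{1}(cat_take_drop i w) => /word_over_cat[].
Qed.

Lemma finitely_generated_finite_index K L :
    is_subgroup L ->
    finite_index_subgroup K L -> finitely_generated K -> finitely_generated L.
Proof.
move=> Ls KL /finitely_generatedP[s eqK]; have [_ sKL _] := KL.
have [T TL LT] := finite_index_cover Ls KL.
apply/finitely_generatedP; exists (s ++ T).
have [C1 CM CV] := subgroup_generated [set` s ++ T].
have subC : [set` s ++ T] `<=` generated [set` s ++ T] by apply: sub_generated.
apply/seteqP; split=> [x Lx|].
  have [t Tt Kx] := LT _ Lx; rewrite -(mulgVK t x); apply: CM.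
    move: Kx; rewrite eqK; apply: generated_sub => [|y sy].
      exact: subgroup_generated.
    by apply: subC; rewrite /= mem_cat; move: sy => /= ->.
  by apply: subC; rewrite /= mem_cat Tt orbT.
apply: generated_sub => // y; rewrite /= mem_cat => /orP[sy|/TL//].
by apply: sKL; rewrite eqK; apply: sub_generated.
Qed.

End Subgroups.

(** * Reduction of words *)

Section Reduction.
Context {G : groupType}.
Implicit Types (X : set G) (a b : G * bool) (u v w : seq (G * bool)).

Lemma reduced_cons a b w :
  reduced (a :: b :: w) = (b != inv_letter a) && reduced (b :: w).
Proof. by []. Qed.

Lemma reduced_behead a w : reduced (a :: w) -> reduced w.
Proof. by case: w => // b w; rewrite reduced_cons => /andP[]. Qed.

Lemma reduced_catl u v : reduced (u ++ v) -> reduced u.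
Proof. by move=> uv; have := cat_sorted2 uv; case. Qed.

Lemma reduced_rcons_cat u a b v :
  reduced (rcons u a) -> reduced (b :: v) -> b != inv_letter a ->
  reduced (rcons u a ++ b :: v).
Proof.
move=> ua bv ab; rewrite /reduced cat_rcons sorted_cat_cons.
by apply/andP; split=> //; rewrite /= ab.
Qed.

Lemma reduced_inv w : reduced w -> reduced (inv_word w).
Proof.
rewrite /reduced /inv_word rev_sorted; case: w => //= a w.
elim: w a => //= b w IH a /andP[ab /IH ->]; rewrite andbT.
apply: contra ab => /eqP eq_a; apply/eqP; rewrite -[LHS]inv_letterK.
exact/esym.
Qed.

Definition cons_reduced a w :=
  if w is b :: w' then if b == inv_letter a then w' else a :: w else [:: a].

(** The reduced form of the concatenation of [u] and a reduced word [v]. *)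
Definition mul_word u v := foldr cons_reduced v u.

Lemma cons_reducedP a w : reduced w -> reduced (cons_reduced a w).
Proof.
case: w => [|b w] //= wr; case: ifPn => [_|ab]; first exact: reduced_behead wr.
exact/andP.
Qed.

Lemma mul_word_reduced u v : reduced v -> reduced (mul_word u v).
Proof. by move=> vr; elim: u => //= a u; apply: cons_reducedP. Qed.

Lemma cons_reduced_value a w :
  word_value (cons_reduced a w) = letter_value a * word_value w.
Proof.
case: w => [|b w] /=; first by rewrite word_value1 word_value_nil mulg1.
case: ifPn => [/eqP ->|_]; last by rewrite word_value_cons.
by rewrite word_value_cons letter_valueV mulVKg.
Qed.

Lemma mul_word_value u v : word_value (mul_word u v) = word_value u * word_value v.
Proof.
elim: u => [|a u IH] /=; first by rewrite word_value_nil mul1g.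
by rewrite cons_reduced_value IH word_value_cons mulgA.
Qed.

Lemma mul_word_over X u v :
  word_over X u -> word_over X v -> word_over X (mul_word u v).
Proof.
move=> Xu Xv; elim: u Xu => //= a u IH /word_over_cons[Xa /IH].
case: mul_word => [_|b w] /=; first by apply/word_over_cons.
by case: ifP => [_ /word_over_cons[]|_ Xw] //; apply/word_over_cons.
Qed.

Lemma reduce_in X w : word_over X w -> reduced_words X (mul_word w [::]).
Proof.
by move=> Xw; split; [apply: mul_word_reduced | apply: mul_word_over].
Qed.

(** Reducing a word only shortcuts the path that it spells from 1 in the Cayley
    graph: the path of the reduced word runs through vertices of the
    original one. *)
Lemma prefix_reduce w i :
  exists j, word_value (take i (mul_word w [::])) = word_value (take j w).
Proof.
elim: w i => [|a w IH] i /=; first by exists 0.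
have keep k : exists j,
    word_value (take k (a :: mul_word w [::])) = word_value (take j (a :: w)).
  case: k => [|k]; first by exists 0.
  have [j eq_j] := IH k; exists j.+1.
  by rewrite /= !word_value_cons eq_j.
case eq_w: (mul_word w [::]) keep (IH i.+1) => [|b v] keep [j eq_j] //=.
case: ifPn => [/eqP eq_b|_] //; exists j.+1.
by rewrite /= word_value_cons -eq_j /= word_value_cons eq_b letter_valueV mulVKg.
Qed.

(** When a reduced word multiplies a reduced word [v], either it is cancelled
    entirely by the beginning of [v], or its first letter survives. *)
Lemma mul_word_cancel b u v : reduced (b :: u) -> reduced v ->
  (exists v', v = inv_word (b :: u) ++ v') \/
  (exists v', mul_word (b :: u) v = b :: v').
Proof.
(* The induction needs to know that what follows the cancelled part of [v] is
   the product, because the next letter acts on it. *)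
suff H : reduced (b :: u) -> reduced v ->
    v = inv_word (b :: u) ++ mul_word (b :: u) v \/
    (exists v', mul_word (b :: u) v = b :: v').
  move=> ur vr; case: (H ur vr) => [eq_v|]; last by right.
  by left; exists (mul_word (b :: u) v).
move=> + vr; elim: u b => [|c u IH] b ur.
  case: v vr => [|d v] vr /=; first by right; exists [::].
  case: ifPn => [/eqP ->|_]; first by left.
  by right; exists (d :: v).
move: ur; rewrite reduced_cons => /andP[cb /IH] [{1}->|[v' eq_v']].
  rewrite -[mul_word (b :: _) v]/(cons_reduced b (mul_word (c :: u) v)).
  case: (mul_word (c :: u) v) => [|d v'] /=; first by right; exists [::].
  case: ifPn => [/eqP ->|_]; last by right; exists (d :: v').
  by left; rewrite [inv_word (b :: _)]inv_word_cons cat_rcons.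
right; exists (c :: v').
rewrite -[mul_word (b :: _) v]/(cons_reduced b (mul_word (c :: u) v)) eq_v' /=.
by rewrite (negPf cb).
Qed.

End Reduction.

(** * Quasiconvex subgroups of free groups *)

Section FreeGroup.
Context {G : groupType}.
Variables (X F : set G).
Hypotheses (XF : is_basis X F) (F_subgroup : is_subgroup F).
Implicit Types (K L N : set G) (u v w : seq (G * bool)).

Lemma basis_sub : X `<=` F.
Proof.
have [Fw _ _] := XF => x Xx; rewrite -[x](word_value1 (x, false)).
by apply: Fw; split=> // a; rewrite inE => /eqP ->.
Qed.

Lemma basis_word x : F x -> exists2 w, reduced_words X w & word_value w = x.
Proof. by have [_ _ FX] := XF; move/FX. Qed.

Lemma basis_words : exists r : G -> seq (G * bool),
  forall x, F x -> reduced_words X (r x) /\ word_value (r x) = x.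
Proof.
pose R x : set (seq (G * bool)) := [set w | reduced_words X w /\ word_value w = x].
exists (fun x => xget [::] (R x)) => x /basis_word[w Xw eq_w].
suff : R x (xget [::] (R x)) by [].
by apply: xgetPex; exists w.
Qed.

Lemma basis_inj v w : reduced_words X v -> reduced_words X w ->
  word_value v = word_value w -> v = w.
Proof. by have [_ inj _] := XF => Xv Xw; apply: inj; rewrite inE. Qed.

(** The vertices met by the paths considered here form the core of the Schreier
    graph of [K]; it is required to be finite. For a finite basis this is
    quasiconvexity for the word metric. *)
Definition quasiconvex K : Prop := exists T : seq G, forall w i,
  reduced_words X w -> K (word_value w) ->
  coset_cover K T (word_value (take i w)).

(** A product of generators of [K] spells a path that returns to [K] after each
    generator, so that it visits boundedly many cosets of [K], and
    reduction does not add vertices to it. *)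
Lemma finitely_generated_quasiconvex K :
  K `<=` F -> finitely_generated K -> quasiconvex K.
Proof.
move=> KF Kfg; have Ks := finitely_generated_subgroup Kfg; have [K1 KM KV] := Ks.
move/finitely_generatedP: Kfg => [s eqK].
have sK : [set` s] `<=` K by rewrite eqK; apply: sub_generated.
have [r rF] := basis_words.
have rP x : x \in s -> reduced_words X (r x) /\ word_value (r x) = x.
  by move=> /sK/KF/rF.
pose ra (a : G * bool) := if a.2 then inv_word (r a.1) else r a.1.
have raP a : a.1 \in s -> word_over X (ra a) /\ word_value (ra a) = letter_value a.
  move=> /rP[[_ Xr] eq_a]; rewrite /ra /letter_value; case: a.2 => //.
  by split; [apply: word_over_inv | rewrite word_valueV eq_a].
pose W := [seq ra (x, e) | x <- s, e <- [:: false; true]].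
have raW a : a.1 \in s -> ra a \in W.
  case: a => x e sx; apply: (allpairs_f (fun x e => ra (x, e))) => //.
  by rewrite !inE; case: (e).
pose T := 1 :: flatten
  [seq [seq word_value (take i w) | i <- iota 0 (size w)] | w <- W].
have expand v : word_over [set` s] v -> exists w, [/\ word_over X w,
    word_value w = word_value v &
    forall i, coset_cover K T (word_value (take i w))].
  elim: v => [|a v IH].
    exists [::]; split=> // i; rewrite word_value_nil; exists 1.
      by rewrite inE eqxx.
    by rewrite invg1 mulg1.
  move=> /word_over_cons[sa /IH[w [Xw eq_w wT]]].
  have [Xa eq_a] := raP _ sa.
  exists (ra a ++ w); split; first exact/word_over_cat.
    by rewrite word_value_cat word_value_cons eq_a eq_w.
  move=> i; rewrite take_cat; case: ltnP => [lt_i|_].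
    exists (word_value (take i (ra a))); last by rewrite mulgV.
    rewrite inE; apply/orP; right; apply/flattenP.
    exists [seq word_value (take i (ra a)) | i <- iota 0 (size (ra a))].
      apply: (map_f (fun w =>
        [seq word_value (take i w) | i <- iota 0 (size w)])).
      exact: raW.
    by apply: (map_f (fun i => word_value (take i (ra a)))); rewrite mem_iota.
  rewrite word_value_cat eq_a; apply: coset_coverMl => //.
  by apply: letter_value_in => //; apply: sK.
exists T => w i Xw; rewrite {1}eqK.
move=> /generatedP[v /expand[w' [Xw' eq_w' w'T]] eq_v].
have -> : w = mul_word w' [::].
  apply: basis_inj => //; first exact: reduce_in.
  by rewrite mul_word_value word_value_nil mulg1 eq_w' eq_v.
by have [j ->] := prefix_reduce w' i.
Qed.

Lemma quasiconvexI K L : is_subgroup K -> is_subgroup L ->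
  quasiconvex K -> quasiconvex L -> quasiconvex (K `&` L).
Proof.
move=> Ks Ls [T KT] [U LU]; have [V sV] := coset_coverI T U Ks Ls.
exists V => w i Xw [Kw Lw]; apply: sV.
by split; [apply: KT | apply: LU].
Qed.

(** The letters occurring in the reduced words of finitely many generators
    suffice to spell every element, and by uniqueness of reduced words a
    basis element is spelled only by itself. *)
Lemma finite_basis : finitely_generated F -> exists s : seq G, X = [set` s].
Proof.
move=> /finitely_generatedP[s eqF].
have sF : [set` s] `<=` F by rewrite eqF; apply: sub_generated.
have [r rF] := basis_words.
have rP x : x \in s -> reduced_words X (r x) /\ word_value (r x) = x.
  by move=> /sF/rF.
pose Y := [seq a.1 | a <- flatten [seq r x | x <- s]].
have YX : [set` Y] `<=` X.
  move=> _ /mapP[a /flattenP[_ /mapP[x sx ->] ra] ->].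
  by have [[_ Xr] _] := rP _ sx; apply: Xr.
exists Y; apply/seteqP; split=> // x Xx.
have : generated [set` Y] x.
  have : F x by apply: basis_sub.
  rewrite eqF; apply: generated_sub; first exact: subgroup_generated.
  move=> y sy; have [_ eq_y] := rP _ sy; apply/generatedP.
  exists (r y) => // a ra; apply: map_f; apply/flattenP; exists (r y) => //.
  exact: map_f.
move=> /generatedP[w Yw eq_x].
have Yr : word_over [set` Y] (mul_word w [::]) by apply: mul_word_over.
have eq_w : mul_word w [::] = [:: (x, false)].
  apply: basis_inj.
  - by apply: reduce_in => a /Yw; apply: YX.
  - by split=> // a; rewrite inE => /eqP ->.
  - by rewrite mul_word_value word_value_nil mulg1 eq_x word_value1.
by apply: (Yr (x, false)); rewrite eq_w inE.
Qed.

Lemma quasiconvex_finitely_generated K :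
    finitely_generated F -> is_subgroup K -> K `<=` F -> quasiconvex K ->
  finitely_generated K.
Proof.
move=> /finite_basis[s eqX] Ks KF [T KT].
apply: (covered_words_finitely_generated (s := s) (T := T) Ks) => k Kk.
have [w Xw eq_w] := basis_word (KF _ Kk); exists w; split=> //.
  by rewrite -eqX; case: Xw.
by move=> i; apply: KT => //; rewrite eq_w.
Qed.

(** This is Howson's theorem. *)
Lemma finitely_generatedI K L :
    finitely_generated F -> K `<=` F -> L `<=` F ->
    finitely_generated K -> finitely_generated L ->
  finitely_generated (K `&` L).
Proof.
move=> Ffg KF LF Kfg Lfg.
have Ks := finitely_generated_subgroup Kfg.
have Ls := finitely_generated_subgroup Lfg.
apply: quasiconvex_finitely_generated => //; first exact: subgroupI.
  by move=> x [/KF].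
by apply: quasiconvexI => //; apply: finitely_generated_quasiconvex.
Qed.

(** An element of minimal length is cyclically reduced: otherwise conjugating
    by its first letter would shorten it. *)
Lemma cyclically_reduced_word N w :
    (forall n f, N n -> F f -> N (f^-1 * n * f)) ->
    reduced_words X w -> w <> [::] -> N (word_value w) ->
  exists b u, [/\ reduced_words X (b :: u), N (word_value (b :: u)) &
    b != inv_letter (last b u)].
Proof.
move=> NF; have [m] := ubnP (size w); elim: m w => // m IH [|b u] //= lt_m Xw _ Nw.
have [eq_b|] := eqVneq b (inv_letter (last b u)); last by exists b, u.
case/lastP: u => [|u c] in lt_m Xw Nw eq_b *.
  by move: eq_b; case: (b) => x [].
rewrite last_rcons in eq_b.
have [ur Xbu] := Xw; have [Xb Xuc] := (word_over_cons _ _ _).1 Xbu.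
case: u => [|d u] in lt_m Xw Nw ur Xbu Xuc *.
  by move: ur; rewrite -[rcons _ _]/[:: c] eq_b reduced_cons inv_letterK eqxx.
apply: (IH (d :: u)) => //.
- by move: lt_m; rewrite size_rcons; apply: ltnW.
- split; last by move: Xuc; rewrite -cats1 => /word_over_cat[].
  by move/reduced_behead: ur; rewrite -cats1; apply: reduced_catl.
have Fb : F (letter_value b) by apply: letter_value_in => //; apply: basis_sub.
have := NF _ _ Nw Fb; rewrite -cats1 word_value_cons word_value_cat word_value1.
by rewrite mulKg eq_b letter_valueV mulgK.
Qed.

(** Let [f] in [F] be spelled by the reduced word [w]. Some nontrivial element
    [n] of [N], spelled by a cyclically reduced word [u], can be chosen such
    that [w ++ u] is reduced. If [w^-1] does not cancel all of [u], then [w] is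
    a prefix of the reduced word of the element [f * n * f^-1] of [K], so [f]
    lies in a coset met by such prefixes; otherwise [w] ends with [u] and the
    shorter element [f * n^-1] lies in the coset [K f]. *)
Lemma coset_cover_of_normal K N :
    is_subgroup K -> is_subgroup N -> N `<=` K -> N `<=` F ->
    (forall n f, N n -> F f -> N (f^-1 * n * f)) ->
    (exists2 n, N n & n <> 1) -> quasiconvex K ->
  exists T, F `<=` coset_cover K T.
Proof.
move=> Ks Ns NK NF normN [n0 Nn0 n0_neq1] [T KT]; exists T.
have [K1 _ _] := Ks; have [_ _ NV] := Ns; have [_ _ FV] := F_subgroup.
have [b0 [u0 [Xu0 Nu0 cyc0]]] : exists b u, [/\ reduced_words X (b :: u),
    N (word_value (b :: u)) & b != inv_letter (last b u)].
  have [w Xw eq_w] := basis_word (NF _ Nn0).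
  apply: (cyclically_reduced_word normN Xw); last by rewrite eq_w.
  by move=> w0; apply: n0_neq1; rewrite -eq_w w0 word_value_nil.
(* Since [u0] is cyclically reduced, its first letter and that of its inverse
   cannot both cancel against the same letter. *)
have avoid a : exists b u, [/\ reduced_words X (b :: u),
    N (word_value (b :: u)) & b != inv_letter a].
  have [eq_b|] := eqVneq b0 (inv_letter a); last by exists b0, u0.
  have [u0r Xbu0] := Xu0.
  have eq_i : inv_word (b0 :: u0) =
      inv_letter (last b0 u0) :: inv_word (belast b0 u0).
    by rewrite lastI -cats1 inv_word_cat.
  exists (inv_letter (last b0 u0)), (inv_word (belast b0 u0)).
  rewrite -eq_i word_valueV; split; last by rewrite -eq_b eq_sym.
    by split; [apply: reduced_inv | apply: word_over_inv].
  exact: NV.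
suff cover w : reduced_words X w -> coset_cover K T (word_value w).
  by move=> f Ff; have [w Xw <-] := basis_word Ff; apply: cover.
have [m] := ubnP (size w); elim: m w => // m IH w.
case/lastP: w => [_ Xw|w a lt_m Xwa].
  by apply: (KT [::] 0) => //; rewrite word_value_nil.
have [b [u [Xbu Nbu ab]]] := avoid a.
have [war Xwa'] := Xwa; have [bur Xbu'] := Xbu.
set wa := rcons w a in lt_m war Xwa Xwa' *.
set n := word_value (b :: u) in Nbu.
case: (mul_word_cancel bur (reduced_inv war)) => [[v' eq_v]|[z eq_z]].
  have eq_wa : wa = inv_word v' ++ b :: u.
    by rewrite -[wa]inv_wordK eq_v inv_word_cat inv_wordK.
  have Xv : reduced_words X (inv_word v').
    move: war Xwa'; rewrite eq_wa => vr /word_over_cat[Xv _].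
    by split=> //; apply: reduced_catl vr.
  have lt_v : size (inv_word v') < m.
    move: lt_m; rewrite ltnS eq_wa size_cat /= addnS; apply: leq_trans.
    by rewrite ltnS leq_addr.
  have Fv : F (word_value (inv_word v')).
    by apply: word_value_in basis_sub _ => //; case: Xv.
  rewrite eq_wa word_value_cat -/n.
  set y := word_value (inv_word v') in Fv *.
  have -> : y * n = (y * n * y^-1) * y by rewrite mulgVK.
  apply: coset_coverMl => //; last exact: IH.
  by apply: NK; rewrite -{1}[y]invgK; apply: normN => //; apply: (FV).
have Fw : F (word_value wa) by apply: word_value_in basis_sub _.
have eq_val : word_value (b :: z) = n * (word_value wa)^-1.
  by rewrite -eq_z mul_word_value word_valueV.
have Xwz : reduced_words X (wa ++ b :: z).
  have bzr : reduced (b :: z) by rewrite -eq_z; apply/mul_word_reduced/reduced_inv.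
  split; first exact: reduced_rcons_cat.
  apply/word_over_cat; split=> //; rewrite -eq_z; apply: mul_word_over => //.
  exact: word_over_inv.
have := KT _ (size wa) Xwz; rewrite take_size_cat //; apply.
rewrite word_value_cat eq_val mulgA; apply: NK.
by rewrite -{1}[word_value wa]invgK; apply: normN => //; apply: FV.
Qed.

End FreeGroup.

(** * Images and preimages under an endomorphism *)

Section Endomorphism.
Context {G : groupType}.
Variable phi : {multiplicative G -> G}.
Implicit Types (H K L : set G).

Lemma morph1 : phi 1 = 1.
Proof. by apply: (mulgI (phi 1)); rewrite -gmulfM !mulg1. Qed.

Lemma morphV x : phi x^-1 = (phi x)^-1.
Proof. by apply/esym/mulg1_eq; rewrite -gmulfM mulgV morph1. Qed.

Lemma preimage_subgroup H : is_subgroup H -> is_subgroup (phi @^-1` H).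
Proof.
move=> [H1 HM HV]; split=> [|x y Hx Hy|x Hx] /=; first by rewrite morph1.
  by rewrite gmulfM; apply: HM.
by rewrite morphV; apply: HV.
Qed.

Lemma image_subgroup L : is_subgroup L -> is_subgroup (phi @` L).
Proof.
move=> [L1 LM LV]; split; first by exists 1; rewrite ?morph1.
  move=> _ _ [x Lx <-] [y Ly <-]; exists (x * y); last exact: gmulfM.
  exact: LM.
by move=> _ [x Lx <-]; exists x^-1; [apply: LV | apply: morphV].
Qed.

Lemma kernel_subgroup : is_subgroup (phi @^-1` [set 1]).
Proof.
apply: preimage_subgroup; split=> // [x y -> ->|x ->] /=; first by rewrite mulg1.
by rewrite invg1.
Qed.

Lemma finitely_generated_range :
  finitely_generated [set: G] -> finitely_generated (range phi).
Proof.
move=> /finitely_generatedP[s eqG].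
apply/finitely_generatedP; exists (map phi s).
have Cs := subgroup_generated [set` map phi s].
apply/seteqP; split; last first.
  apply: generated_sub; first exact: image_subgroup.
  by move=> _ /mapP[x _ ->]; exists x.
move=> _ [x _ <-]; have : [set: G] x by [].
rewrite eqG; apply: (generated_sub (preimage_subgroup Cs)) => y sy.
by apply: sub_generated; apply: map_f.
Qed.

(** [phi] induces a bijection between the cosets on the two sides. *)
Lemma finite_index_image H L : is_subgroup H -> is_subgroup L ->
  finite_index_subgroup (phi @^-1` H `&` L) L <->
  finite_index_subgroup (H `&` phi @` L) (phi @` L).
Proof.
move=> Hs Ls; have iLs := image_subgroup Ls.
split=> [/(finite_index_cover Ls)|/(finite_index_cover iLs)] [T TL LT].
  apply: (cover_finite_index (T := map phi T)) => //.
  - exact: subgroupI.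
  - move=> _ [x /LT[t Tt [Hx Lx]] <-]; exists (phi t); first exact: map_f.
    by rewrite -morphV -gmulfM; split=> //; exists (x * t^-1).
pose P y : set G := [set x | L x /\ phi x = y].
apply: (cover_finite_index (T := [seq xget 1 (P t) | t <- T])) => //.
- by apply: subgroupI => //; apply: preimage_subgroup.
- move=> x Lx; have [t Tt [Hx _]] : coset_cover (H `&` phi @` L) T (phi x).
    by apply: LT; exists x.
  exists (xget 1 (P t)); first exact: (map_f (fun t => xget 1 (P t))).
  have [Ly eq_y] : P t (xget 1 (P t)).
    by apply: xgetPex; have [y Ly <-] := TL _ Tt; exists y.
  split; last exact: subgroup_div.
  by rewrite /= gmulfM morphV eq_y.
Qed.

Lemma finitely_generated_preimage H :
    finite_set (phi @^-1` [set 1]) -> H `<=` range phi -> finitely_generated H ->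
  finitely_generated (phi @^-1` H).
Proof.
move=> /finite_seqP[ker eq_ker] HR Hfg.
have pHs := preimage_subgroup (finitely_generated_subgroup Hfg).
have [H1 _ _] := finitely_generated_subgroup Hfg.
move/finitely_generatedP: Hfg => [s eqH].
pose P y : set G := [set x | phi x = y].
have PP y : H y -> phi (xget 1 (P y)) = y.
  move=> /HR[x _ eq_x]; suff : P y (xget 1 (P y)) by [].
  by apply: xgetPex; exists x.
have sH : [set` s] `<=` H by rewrite eqH; apply: sub_generated.
pose C := [seq xget 1 (P y) | y <- s] ++ ker.
have Cs := subgroup_generated [set` C]; have [_ CM _] := Cs.
apply/finitely_generatedP; exists C; apply/seteqP; split; last first.
  apply: generated_sub => // x; rewrite /= mem_cat => /orP[/mapP[y sy ->]|kx].
    by rewrite PP //; apply: sH.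
  have : phi x = 1 by have : [set` ker] x by []; rewrite -eq_ker.
  by move=> ->.
have lift : H `<=` phi @` generated [set` C].
  rewrite {1}eqH; apply: generated_sub; first exact: image_subgroup.
  move=> y sy; exists (xget 1 (P y)); last by apply: PP; apply: sH.
  apply: sub_generated; rewrite /= mem_cat; apply/orP; left.
  exact: (map_f (fun y => xget 1 (P y))).
move=> x /= /lift[z Cz eq_z]; rewrite -(mulgVK z x); apply: CM => //.
apply: sub_generated; rewrite /= mem_cat; apply/orP; right.
suff : [set` ker] (x * z^-1) by [].
by rewrite -eq_ker /= gmulfM morphV eq_z mulgV.
Qed.

End Endomorphism.

(** * Virtually free groups *)

Section VirtuallyFree.
Context {G : groupType}.
Variable F : set G.
Hypotheses (F_free : is_free F) (F_fin_index : finite_index_subgroup F [set: G]).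
Hypothesis (G_fg : finitely_generated [set: G]).
Implicit Types (K L N : set G).

Let F_subgroup : is_subgroup F. Proof. by case: F_fin_index. Qed.

Let F_fg : finitely_generated F.
Proof. exact: finite_index_finitely_generated G_fg. Qed.

Lemma finite_index_interF K : is_subgroup K -> finite_index_subgroup (K `&` F) K.
Proof.
move=> Ks; rewrite setIC -{2}[K]setTI.
exact: finite_indexI subgroupT Ks F_fin_index.
Qed.

Lemma finitely_generated_interF K :
  finitely_generated K -> finitely_generated (K `&` F).
Proof.
move=> Kfg; apply: finite_index_finitely_generated (Kfg).
exact/finite_index_interF/finitely_generated_subgroup.
Qed.

(** Intersecting with [F] changes neither subgroup, nor their intersection, by
    more than a finite index, so finite generation can be tested inside [F]. *)
Lemma virtually_free_Howson K L :
  finitely_generated K -> finitely_generated L -> finitely_generated (K `&` L).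
Proof.
move=> Kfg Lfg; have [X XF] := F_free.
have KLs : is_subgroup (K `&` L).
  by apply: subgroupI; apply: finitely_generated_subgroup.
apply: (finitely_generated_finite_index KLs (finite_index_interF KLs)).
rewrite -{1}[F]setIid setIACA.
apply: (finitely_generatedI XF) => //; try exact: subIsetr.
  exact: finitely_generated_interF.
exact: finitely_generated_interF.
Qed.

(** If [N] met [F] trivially, every coset of [F] would contain at most one
    element of [N]. *)
Lemma infinite_meets_free N : is_subgroup N -> ~ finite_set N ->
  exists2 n, (N `&` F) n & n <> 1.
Proof.
move=> Ns Ninf; apply: contrapT => no_n; apply: Ninf.
have [T _ NT] := finite_index_cover Ns (finite_index_interF Ns).
apply: sub_finite_set (finite_seq T) => x /NT[t Tt Nx].
have [/divg1_eq -> //|/eqP x_neq] := eqVneq (x * t^-1) 1.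
by case: no_n; exists (x * t^-1).
Qed.

Lemma finite_index_of_normal K N :
    finitely_generated K -> is_subgroup N -> N `<=` K -> ~ finite_set N ->
    (forall n g, N n -> N (g^-1 * n * g)) ->
  finite_index_subgroup (K `&` F) F.
Proof.
move=> Kfg Ns NK Ninf normN; have [X XF] := F_free.
have KFfg := finitely_generated_interF Kfg.
have KFs := finitely_generated_subgroup KFfg.
have [_ FM FV] := F_subgroup.
have [T FT] : exists T, F `<=` coset_cover (K `&` F) T.
  apply: (coset_cover_of_normal XF F_subgroup (N := N `&` F)) => //.
  - exact: subgroupI.
  - exact: setSI.
  - move=> n f [Nn Fn] Ff; split; first exact: normN.
    by apply: (FM) => //; apply: FM => //; apply: FV.
  - exact: infinite_meets_free.
  - by apply: (finitely_generated_quasiconvex XF).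
exact: cover_finite_index FT.
Qed.

End VirtuallyFree.

Theorem proposition5p12 (G : groupType) (F H : set G)
    (phi : {multiplicative G -> G})
    (G_fg : finitely_generated [set: G])
    (F_free : is_free F) (F_fin_index : finite_index_subgroup F [set: G])
    (H_subgroup : is_subgroup H) :
  (finite_set (phi @^-1` [set 1]) ->
     finitely_generated H -> finitely_generated (phi @^-1` H)) /\
  (~ finite_set (phi @^-1` [set 1]) ->
     [<-> finitely_generated (phi @^-1` H);
          finite_index_subgroup (phi @^-1` H `&` F) F;
          finite_index_subgroup (phi @^-1` H `&` F) [set: G];
          finite_index_subgroup (phi @^-1` H) [set: G];
          finite_index_subgroup (H `&` range phi) (range phi);
          finite_index_subgroup (H `&` (phi @` F)) (phi @` F)]).
Proof.
have Fs : is_subgroup F by case: F_fin_index.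
have pHs := preimage_subgroup phi H_subgroup.
split=> [ker_fin H_fg|ker_inf].
  have -> : phi @^-1` H = phi @^-1` (H `&` range phi).
    by apply/seteqP; split=> x; [split=> //; exists x | case].
  apply: finitely_generated_preimage ker_fin _ _; first by move=> x [].
  apply: (virtually_free_Howson F_free) => //.
  exact: finitely_generated_range.
have FtoG : finite_index_subgroup (phi @^-1` H `&` F) F ->
    finite_index_subgroup (phi @^-1` H `&` F) [set: G].
  by move=> HF; apply: finite_index_trans HF F_fin_index.
have GtoH : finite_index_subgroup (phi @^-1` H `&` F) [set: G] ->
    finite_index_subgroup (phi @^-1` H) [set: G].
  move=> /(finite_index_cover subgroupT)[T _ GT].
  apply: (cover_finite_index (T := T)) => // x /GT[t Tt [Hx _]].
  by exists t.
tfae.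
- move=> pH_fg; apply: (finite_index_of_normal F_free F_fin_index pH_fg _ _ ker_inf).
  + exact: (kernel_subgroup phi).
  + by move=> x /= ->; case: H_subgroup.
  + by move=> n g /= n1; rewrite !gmulfM n1 mulg1 -gmulfM mulVg morph1.
- exact: FtoG.
- exact: GtoH.
- rewrite -[X in finite_index_subgroup X _]setIT.
  by case: (finite_index_image phi H_subgroup (@subgroupT G)).
- move=> /(finite_indexI (image_subgroup phi subgroupT) (image_subgroup phi Fs)).
  suff sF : phi @` F `<=` range phi by rewrite -setIA (setIidr sF).
  exact: image_subset.
- move=> /(finite_index_image phi H_subgroup Fs)/FtoG/GtoH HG.
  exact: finite_index_finitely_generated HG G_fg.
Qed.
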